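(* Let $(\widetilde{Sq}^0_* )_{(5,24)}:(\mathbb F_2\otimes_{\mathcal A}P_5)_{53}\to(\mathbb F_2\otimes_{\mathcal A}P_5)_{24}$ be the Kameko homomorphism. There is a direct sum decomposition of $\mathbb F_2$-vector spaces $$\operatorname{Ker}(\widetilde{Sq}^0_* )_{(5,24)}\cong(QP_5^0)_{53}\oplus QP_5^+(3,3,3,2,1).$$
   Context: $P_k=\mathbb F_2[x_1,\dots,x_k]$, $\deg x_j=1$, module over the mod-2 Steenrod algebra $\mathcal A$ with augmentation ideal $\mathcal A^+$. The Kameko homomorphism $(\widetilde{Sq}^0_* )_{(k,d)}:(\mathbb F_2\otimes_{\mathcal A}P_k)_{2d+k}\to(\mathbb F_2\otimes_{\mathcal A}P_k)_d$ is induced by the linear map sending a monomial $x$ to $y$ if $x=x_1\cdots x_ky^2$ and to $0$ otherwise. $P_k^0$ (resp. $P_k^+$) is spanned by monomials $x_1^{a_1}\cdots x_k^{a_k}$ with $a_1\cdots a_k=0$ (resp. $>0$); $QP_k^0=\mathbb F_2\otimes_{\mathcal A}P_k^0$. For a monomial $x$ with exponents $\nu_j(x)$, $\omega(x)=(\omega_1,\omega_2,\dots)$ with $\omega_i(x)=\sum_j\alpha_{i-1}(\nu_j(x))$, $\alpha_t$ the $t$-th binary digit. For a weight vector $\omega$ (here $(3,3,3,2,1)$, of degree $\sum_i2^{i-1}\omega_i=53$), $P_k(\omega)$ is spanned by monomials $y$ of degree $\deg\omega$ with $\omega(y)\le\omega$ and $P_k^-(\omega)$ by those with $\omega(y)<\omega$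 (left-lexicographic order); $QP_k^+(\omega)=(P_k^+\cap P_k(\omega))/\big((\mathcal A^+P_k\cap P_k^+\cap P_k(\omega))+(P_k^+\cap P_k^-(\omega))\big)$. *)

(* Defs.v *)
From HB Require Import structures.
From mathcomp Require Import all_boot all_order all_algebra.
Set Implicit Arguments. Unset Strict Implicit. Unset Printing Implicit Defensive.
Import GRing.Theory.
Local Open Scope ring_scope.

Definition F2 : fieldType := 'F_2.

(** Monomials x_1^{a_1}...x_k^{a_k} of degree d in P_k = F_2[x_1,...,x_k],
    given by their exponent vectors (each exponent is <= d). *)
Definition mon (k d : nat) : finType :=
  {a : {ffun 'I_k -> 'I_d.+1} | (\sum_(j < k) (a j : nat) == d)%N}.

Definition expo k d (a : mon k d) (j : 'I_k) : nat := val a j.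

(** The homogeneous component (P_k)_d: F_2-linear combinations of the
    monomials of degree d (a polynomial = its coefficient function). *)
Definition Pd (k d : nat) := {ffun mon k d -> F2^o}.

Definition monom k d (a : mon k d) : Pd k d := [ffun b => (b == a)%:R].

Definition mspan k d (p : pred (mon k d)) : {vspace Pd k d} :=
  <<[seq monom a | a <- enum (mon k d) & p a]>>%VS.

(** Steenrod square Sq^(d-e) : (P_k)_e -> (P_k)_d, given on monomials by the
    Cartan formula with Sq(x_j) = x_j + x_j^2:
    Sq^i(x^a) = sum_{b, |b|-|a| = i} prod_j binom(a_j, b_j - a_j) x^b  (mod 2). *)
Definition sqcoef k e d (a : mon k e) (b : mon k d) : F2 :=
  (\prod_(j < k) (if (expo a j <= expo b j)%N
                  then 'C(expo a j, expo b j - expo a j) else 0%N))%N%:R.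

Definition Sq k e d (f : Pd k e) : Pd k d :=
  [ffun b => \sum_(a : mon k e) f a * sqcoef a b].

(** (A^+ P_k)_d = sum_{i>0} Sq^i (P_k)_{d-i}  (A^+ is generated by the Sq^i). *)
Definition hit k d : {vspace Pd k d} :=
  (\sum_(e < d) (linfun (@Sq k e d) @: fullv))%VS.

Definition P0pred k d : pred (mon k d) := fun a => [exists j, expo a j == 0%N].
Definition Pplus_pred k d : pred (mon k d) := fun a => [forall j, expo a j != 0%N].

Definition P0 k d : {vspace Pd k d} := mspan (@P0pred k d).
Definition Pplus k d : {vspace Pd k d} := mspan (@Pplus_pred k d).

Definition hit0 k d : {vspace Pd k d} :=
  (\sum_(e < d) (linfun (@Sq k e d) @: P0 k e))%VS.

(** Dimension of the quotient of the subspace U by W (i.e. of U/(U :&: W),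
    which is U/W when W is contained in U). *)
Definition qdim (vT : vectType F2) (U W : {vspace vT}) : nat :=
  (\dim U - \dim (U :&: W))%N.

(** Kameko's map on representatives: (P_k)_(2m+k) -> (P_k)_m,
    x |-> y if x = x_1...x_k y^2, and 0 otherwise. *)
Definition kam k m (f : Pd k (m.*2 + k)) : Pd k m :=
  [ffun b => \sum_(a : mon k (m.*2 + k) | [forall j, expo a j == (expo b j).*2.+1])
               f a].

(** Ker of the induced map (Sq0~)_(k,m) on (QP_k)_(2m+k) = (P_k)_(2m+k)/hit:
    the classes of the f with kam f hit, i.e. (kam^-1(hit_m) + hit)/hit. *)
Definition dim_ker_kameko k m : nat :=
  qdim (linfun (@kam k m) @^-1: hit k m)%VS (hit k (m.*2 + k)).

(** Weight vector omega(a), truncated to length d+1 (enough since a_j <= d). *)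
Definition omega k d (a : mon k d) : seq nat :=
  [seq (\sum_(j < k) odd (expo a j %/ 2 ^ i))%N | i <- iota 0 d.+1].

Definition padw (n : nat) (w : seq nat) : seq nat := take n (w ++ nseq n 0%N).

Fixpoint lexlt (s t : seq nat) : bool :=
  match s, t with
  | x :: s', y :: t' => (x < y)%N || ((x == y) && lexlt s' t')
  | _, _ => false
  end.

Definition Pw k d (w : seq nat) : {vspace Pd k d} :=
  mspan (fun a : mon k d => (omega a == padw d.+1 w) || lexlt (omega a) (padw d.+1 w)).
Definition Pwminus k d (w : seq nat) : {vspace Pd k d} :=
  mspan (fun a : mon k d => lexlt (omega a) (padw d.+1 w)).

Definition degw (w : seq nat) : nat := (\sum_(i < size w) nth 0 w i * 2 ^ i)%N.

Definition dim_QPplus_w k (w : seq nat) : nat :=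
  let d := degw w in
  qdim (Pplus k d :&: Pw k d w)%VS
       ((hit k d :&: Pplus k d :&: Pw k d w) + (Pplus k d :&: Pwminus k d w))%VS.

Definition dim_QP0 k d : nat := qdim (P0 k d) (hit0 k d).

(* Main.v *)
Require Import Defs.
From HB Require Import structures.
From mathcomp Require Import all_boot all_order all_fingroup all_algebra.
From mathcomp Require Import zify.

(** Write a monomial as [x^p * y ^ 2] with [p] square-free; the map [phi p : f |-> x^p * f ^ 2]
    sends hit polynomials to hit ones, up to monomials of smaller first weight.  Since
    [P_5] splits as [P_5^0 + P_5^+] over the Steenrod algebra and Kameko's map kills [P_5^0],
    the theorem amounts to two facts in degree 53: every monomial of weight below (3,3,3,2,1)
    is hit, and every monomial of first weight 3 is hit modulo [P_5(3,3,3,2,1)].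

    Peeling off [phi p] with [|p| = 3], the first fact reduces to monomials of first weight 1
    in degrees 53, 25, 11 (and 0 in degree 4), for which a telescoping sum of squares
    works because 27, 13, 6 are not powers of two.  For the second, the weights (3,5,..)
    reduce to (3,3,..) by one application of [Sq^1], and what remains is that in degree 25 the
    weight (3,3,4) is hit modulo smaller weights: up to the action of S_5 there are nine
    monomials, each of which is a sum of at most seven relations [Sq^1 z] or [phi p (Sq^1 z)]. *)

Set Implicit Arguments. Unset Strict Implicit. Unset Printing Implicit Defensive.
Import GRing.Theory.
Local Open Scope ring_scope.

(** * Monomials and linear algebra *)

Lemma F2_addxx (x : F2) : x + x = 0.
Proof. by case: x => [[|[|?]] ?] //; apply/val_inj. Qed.

Lemma F2_natr (n : nat) : n%:R = (odd n)%:R :> F2.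
Proof.
elim: n => // n IHn; rewrite -natr1 IHn /=.
by case: (odd n); rewrite //= ?addr0 ?add0r // F2_addxx.
Qed.

Section Linear.
Variables (k e d : nat).

Fact Sq_is_linear : linear (@Sq k e d).
Proof.
move=> c f g; apply/ffunP => b; rewrite !ffunE scaler_sumr -big_split /=.
by apply: eq_bigr => a _; rewrite !ffunE mulrDl scalerAl.
Qed.
HB.instance Definition _ := GRing.isLinear.Build F2 (Pd k e) (Pd k d) _ (@Sq k e d) Sq_is_linear.

End Linear.

Fact kam_is_linear k m : linear (@kam k m).
Proof.
move=> c f g; apply/ffunP => b; rewrite !ffunE scaler_sumr -big_split /=.
by apply: eq_bigr => a _; rewrite !ffunE.
Qed.
HB.instance Definition _ k m :=
  GRing.isLinear.Build F2 (Pd k (m.*2 + k)) (Pd k m) _ (@kam k m) (@kam_is_linear k m).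

Section Monomials.
Variable k : nat.
Implicit Types (d : nat) (e : 'I_k -> nat).

(** The monomial [x ^ e] in degree [d]; it is [0] when [e] does not have degree [d]. *)
Definition xpow d e : Pd k d := [ffun b => [forall j, expo b j == e j]%:R].

Lemma xpowE d e (b : mon k d) : xpow d e b = [forall j, expo b j == e j]%:R.
Proof. by rewrite ffunE. Qed.

Lemma eq_xpow d e1 e2 : e1 =1 e2 -> xpow d e1 = xpow d e2.
Proof.
move=> E; apply/ffunP => b; rewrite !ffunE; congr (nat_of_bool _)%:R.
by apply: eq_forallb => j; rewrite E.
Qed.

Lemma expo_sum d (a : mon k d) : (\sum_j expo a j = d)%N.
Proof. exact: (eqP (valP a)). Qed.

Lemma expo_inj d (a b : mon k d) : expo a =1 expo b -> a = b.
Proof. by move=> E; apply/val_inj/ffunP => j; apply/val_inj/E. Qed.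

Lemma expo_eqE d (a b : mon k d) : [forall j, expo b j == expo a j] = (b == a).
Proof.
apply/forallP/eqP => [E|-> j //]; exact: (expo_inj (fun j => eqP (E j))).
Qed.

Lemma monom_xpow d (a : mon k d) : monom a = xpow d (expo a).
Proof. by apply/ffunP => b; rewrite !ffunE expo_eqE. Qed.

Lemma expo_exists d e : (\sum_j e j = d)%N -> exists a : mon k d, expo a =1 e.
Proof.
move=> De; have le_e j : (e j < d.+1)%N by rewrite ltnS -De (bigD1 j) //= leq_addr.
pose f : {ffun 'I_k -> 'I_d.+1} := [ffun j => Ordinal (le_e j)].
have Df : (\sum_j (f j : nat) == d)%N.
  by rewrite -[X in _ == X]De; apply/eqP/eq_bigr => j _; rewrite ffunE.
by exists (Sub f Df) => j; rewrite /expo SubK ffunE.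
Qed.

Lemma PdD d (f g : Pd k d) b : (f + g) b = f b + g b.
Proof. exact: ffunE. Qed.

Lemma PdZ d c (f : Pd k d) b : (c *: f) b = c * f b.
Proof. exact: ffunE. Qed.

Lemma Pd_sumE d (I : Type) (r : seq I) (P : pred I) (F : I -> Pd k d) b :
  (\sum_(i <- r | P i) F i) b = \sum_(i <- r | P i) F i b.
Proof.
by apply: (big_morph (fun f : Pd k d => f b)) => [f g|]; [exact: PdD|exact: ffunE].
Qed.

Lemma monomE d (a b : mon k d) : monom a b = (b == a)%:R.
Proof. exact: ffunE. Qed.

Lemma Pd_sum d (f : Pd k d) : f = \sum_a f a *: monom a.
Proof.
apply/ffunP => b; rewrite Pd_sumE (bigD1 b) //= big1 => [|a /negPf ab].
  by rewrite addr0 [RHS]PdZ monomE eqxx mulr1.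
by rewrite [LHS]PdZ monomE eq_sym ab mulr0.
Qed.

Lemma mem_mspan d (p : pred (mon k d)) (f : Pd k d) : (forall a, f a != 0 -> p a) -> f \in mspan p.
Proof.
move=> pf; rewrite [f]Pd_sum; apply: memv_suml => a _.
have [->|/pf pa] := eqVneq (f a) 0; first by rewrite scale0r mem0v.
by apply/memvZ/memv_span/map_f; rewrite mem_filter pa mem_enum.
Qed.

Lemma mspan_subv d (p : pred (mon k d)) (V : {vspace Pd k d}) :
  (forall a, p a -> monom a \in V) -> (mspan p <= V)%VS.
Proof.
move=> pV; apply/span_subvP => f /mapP[a]; rewrite mem_filter => /andP[pa _] ->.
exact: pV.
Qed.

Lemma Pd_addxx d (f : Pd k d) : f + f = 0.
Proof. by apply/ffunP => b; rewrite [LHS]PdD [RHS]ffunE F2_addxx. Qed.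

Definition proj d (p : pred (mon k d)) (f : Pd k d) : Pd k d :=
  [ffun a => if p a then f a else 0].

Fact proj_is_linear d (p : pred (mon k d)) : linear (proj p).
Proof.
move=> c f g; apply/ffunP => b; rewrite [LHS]ffunE [RHS]PdD [in RHS]PdZ.
rewrite [in RHS]ffunE [proj p g b]ffunE; case: (p b); last by rewrite mulr0 addr0.
by rewrite [LHS]PdD PdZ.
Qed.
HB.instance Definition _ d (p : pred (mon k d)) :=
  GRing.isLinear.Build F2 (Pd k d) (Pd k d) _ (proj p) (proj_is_linear p).

Lemma projE d (p : pred (mon k d)) (f : Pd k d) a : proj p f a = if p a then f a else 0.
Proof. exact: ffunE. Qed.

(** The projection onto the monomials in [p] fixes every generator, hence the whole span, so no
    coefficient outside [p] survives. *)
Lemma mspanP d (p : pred (mon k d)) (f : Pd k d) :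
  reflect (forall a, f a != 0 -> p a) (f \in mspan p).
Proof.
apply: (iffP idP) => [pf|]; last exact: mem_mspan.
have: f \in fixedSpace (linfun (proj p)).
  apply: subvP pf; apply: mspan_subv => a pa; apply/fixedSpaceP; rewrite lfunE /=.
  apply/ffunP => b; rewrite projE monomE; case: eqP => [->|_]; last by rewrite if_same.
  by rewrite pa.
move/fixedSpaceP => <- a; rewrite lfunE /= projE; case: (p a) => //; by rewrite eqxx.
Qed.

Lemma monom_mspan d (p : pred (mon k d)) a : p a -> monom a \in mspan p.
Proof.
by move=> pa; apply: mem_mspan => b; rewrite monomE; case: (b =P a) => [-> //|_]; rewrite eqxx.
Qed.

Lemma Sq_hit d m (f : Pd k m) : (m < d)%N -> Sq d f \in hit k d.
Proof.
move=> lt_md; apply: (subvP (sumv_sup (Ordinal lt_md) isT (subvv _))).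
by rewrite -(lfunE (@Sq k m d)) memv_img ?memvf.
Qed.

Lemma hit_subv d (V : {vspace Pd k d}) :
  (forall m (a : mon k m), (m < d)%N -> Sq d (monom a) \in V) -> (hit k d <= V)%VS.
Proof.
move=> VS; apply/subv_sumP => m _; apply/subvP => _ /memv_imgP[f _ ->].
rewrite lfunE /= [f]Pd_sum linear_sum memv_suml // => a _.
by rewrite linearZ memvZ ?VS.
Qed.

End Monomials.

(** * Steenrod squares of monomials *)

(** The coefficient of [x ^ b] in [x ^ u * (1 + x) ^ n]. *)
Definition sqbin (n u b : nat) : F2 := if (u <= b)%N then 'C(n, b - u)%:R else 0.

Lemma sqbin0 u b : sqbin 0 u b = (u == b)%:R.
Proof.
rewrite /sqbin bin0n; case: leqP => [ub|]; last by rewrite ltn_neqAle eq_sym => /andP[/negPf ->].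
by rewrite subn_eq0 [u == b]eqn_leq ub.
Qed.

Lemma sqbinS n u b : sqbin n.+1 u b = sqbin n u b + sqbin n u.+1 b.
Proof.
rewrite /sqbin; case: (ltngtP u b) => [ub|_|->]; rewrite ?addr0 //.
  by rewrite -{1}(subnSK ub) binS natrD subnSK.
by rewrite subnn !bin0.
Qed.

(* [(1 + x) ^ (2 ^ s) = 1 + x ^ (2 ^ s)] over F_2. *)
Lemma sqbin_pow2 s n u b : sqbin (2 ^ s + n) u b = sqbin n u b + sqbin n (u + 2 ^ s) b.
Proof.
elim: s n u => [|s IHs] n u; first by rewrite add1n addn1 sqbinS.
rewrite expnS mul2n -addnn -addnA !IHs addrACA -!addrA; congr (_ + _).
by rewrite !addrA F2_addxx add0r addnA.
Qed.

(** Over $\mathbb F_2$, $(1+x)^{2c}=(1+x^2)^c$: the parity of the exponent cannot change. *)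
Lemma sqbin_double c u b :
  sqbin c.*2 u b = if odd u == odd b then sqbin c u./2 b./2 else 0.
Proof.
elim: c u => [|c IHc] u.
  rewrite !sqbin0; case: (altP (odd u =P odd b)) => [Eo|]; last first.
    by case: (u =P b) => [->|//]; rewrite eqxx.
  congr (nat_of_bool _)%:R; apply/eqP/eqP => [->//|Eh].
  by rewrite -(odd_double_half u) Eo Eh odd_double_half.
rewrite doubleS -add2n (sqbin_pow2 1) !IHc addn2 /= negbK sqbinS.
by case: ifP => //; rewrite addr0.
Qed.

Lemma sqbin_half a b : odd a = odd b -> sqbin a a b = sqbin a./2 a./2 b./2.
Proof.
move=> Eab; rewrite -{1}(odd_double_half a); case Ea: (odd a) => /=.
  by rewrite add1n sqbinS !sqbin_double Eab eqxx /= -Eab Ea addr0.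
by rewrite add0n sqbin_double Eab eqxx.
Qed.

(** For even [a], $x^a(1+x)^a$ is a polynomial in $x^2$: squares never turn an even exponent into an
    odd one. *)
Lemma sqbin_odd a b : ~~ odd a -> odd b -> sqbin a a b = 0.
Proof.
move=> /negPf Ea Eb; rewrite -{1}(odd_double_half a) Ea add0n sqbin_double.
by rewrite Ea Eb.
Qed.

Section Squares.
Variable k : nat.
Implicit Types (d : nat) (e u : 'I_k -> nat).

(** Indices start at 0: [wt i] is $\omega_{i+1}$. Halving all exponents shifts the sequence by one
    place ([wtS]), which is what drives the inductions on weights. *)
Definition wt i e := (\sum_j odd (e j %/ 2 ^ i))%N.
Definition halfe e := fun j => (e j)./2.

Lemma wtS i e : wt i.+1 e = wt i (halfe e).
Proof. by apply: eq_bigr => j _; rewrite expnS divnMA divn2. Qed.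

Lemma wt0E e : wt 0 e = (\sum_j odd (e j))%N.
Proof. by apply: eq_bigr => j _; rewrite divn1. Qed.

Lemma eq_wt i e1 e2 : e1 =1 e2 -> wt i e1 = wt i e2.
Proof. by move=> E; apply: eq_bigr => j _; rewrite E. Qed.

Lemma deg_half e : (\sum_j e j = wt 0 e + (\sum_j halfe e j).*2)%N.
Proof.
rewrite wt0E -mul2n big_distrr -big_split; apply: eq_bigr => j _.
by rewrite /= mul2n odd_double_half.
Qed.

Lemma wt_le i e : (wt i e <= k)%N.
Proof.
rewrite -[X in (_ <= X)%N]card_ord -sum1_card; apply: leq_sum => j _; exact: leq_b1.
Qed.

Lemma Sq_xpow d m e (b : mon k d) : (\sum_j e j = m)%N ->
  Sq d (xpow m e) b = \prod_j sqbin (e j) (e j) (expo b j).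
Proof.
move=> De; have [a Ea] := expo_exists De; rewrite ffunE (bigD1 a) //=.
rewrite big1 => [|a' /negPf na]; last first.
  rewrite xpowE (_ : [forall j, _] = (a' == a)) ?na ?mul0r //.
  by rewrite -[RHS]na -[RHS](expo_eqE a a'); apply: eq_forallb => j; rewrite Ea.
rewrite addr0 xpowE (_ : [forall j, _] = true); last by apply/forallP => j; rewrite Ea.
rewrite mul1r /sqcoef natr_prod; apply: eq_bigr => j _.
by rewrite /sqbin Ea; case: ifP.
Qed.

Lemma Sq_monom d m (a : mon k m) (b : mon k d) :
  Sq d (monom a) b = \prod_j sqbin (expo a j) (expo a j) (expo b j).
Proof. by rewrite monom_xpow Sq_xpow ?expo_sum. Qed.

Lemma prodF2_0 (F : 'I_k -> F2) j : F j = 0 -> \prod_j F j = 0.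
Proof. by move=> Fj; rewrite (bigD1 j) //= Fj mul0r. Qed.

Lemma eq_leq_sum e u : (forall j, e j <= u j)%N -> (\sum_j e j = \sum_j u j)%N -> e =1 u.
Proof.
move=> le_eu Eeu j; apply/eqP; rewrite eqn_leq le_eu -(leq_add2r (\sum_(i | i != j) u i)).
move: Eeu; rewrite (bigD1 j) //= [in RHS](bigD1 j) //= => <-.
by rewrite leq_add2l leq_sum.
Qed.

(* Both monomials below have degree [d], so the only way to meet [b] is to take
   the top square of each factor. *)
Lemma top_square d e u (b : mon k d) :
  (\sum_j (e j + u j) = d)%N ->
  \prod_j sqbin (e j) (u j) (expo b j) = xpow d (fun j => (e j + u j)%N) b.
Proof.
move=> Dd; rewrite xpowE; case: (boolP [forall j, _]) => [/forallP Eb|nEb].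
  by rewrite big1 // => j _; rewrite (eqP (Eb j)) /sqbin leq_addl addnK binn.
have [j lt_j]: exists j, (e j + u j < expo b j)%N.
  apply/existsP; move: nEb; apply: contraR; rewrite negb_exists => /forallP le_b.
  apply/forallP => j; apply/eqP; move: j.
  apply: (@eq_leq_sum _ (fun j => e j + u j)%N) => [i|]; first by rewrite leqNgt le_b.
  by rewrite expo_sum Dd.
apply: (@prodF2_0 _ j); rewrite /sqbin ifT; last by lia.
by rewrite bin_small //; lia.
Qed.

(** $Sq^m$ is squaring in degree $m$, and [m] is positive. *)
Lemma square_hit m e : (0 < m)%N -> (\sum_j e j = m)%N ->
  xpow (m + m) (fun j => (e j + e j)%N) \in hit k (m + m).
Proof.
move=> m_gt0 De; rewrite (_ : xpow _ _ = Sq (m + m) (xpow m e)).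
  by apply: Sq_hit; rewrite -addn1 leq_add2l.
apply/ffunP => b; rewrite Sq_xpow // top_square // big_split /= De //.
Qed.

(** $Sq^1$ is the derivation with $Sq^1x_i=x_i^2$. *)
Lemma Sq1_xpow d e : (\sum_j e j = d)%N ->
  Sq d.+1 (xpow d e) = \sum_(i | odd (e i)) xpow d.+1 (fun j => (e j + (j == i))%N).
Proof.
move=> De; apply/ffunP => b; rewrite Sq_xpow // Pd_sumE.
case: (boolP [forall j, e j <= expo b j]%N) => [/forallP le_eb|]; last first.
  rewrite negb_forall => /existsP[j]; rewrite -ltnNge => lt_be.
  rewrite (@prodF2_0 _ j) ?big1 // => [i _|]; last by rewrite /sqbin leqNgt lt_be.
  rewrite xpowE; case: forallP => // /(_ j)/eqP Eb.
  by rewrite Eb ltnNge leq_addr in lt_be.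
(* The degree of [b] is one more than that of [e], so [b] exceeds [e] at exactly one variable. *)
have [i lt_i]: exists i, (e i < expo b i)%N.
  apply/existsP; apply: contraT; rewrite negb_exists => /forallP ge_eb.
  suff: (d.+1 <= d)%N by rewrite ltnn.
  rewrite -[X in (X <= _)%N](expo_sum b) -[X in (_ <= X)%N]De.
  by apply: leq_sum => j _; rewrite leqNgt.
have Eb: (fun j => (e j + (j == i))%N) =1 expo b.
  apply: eq_leq_sum => [j|]; first by case: eqP => [->|]; rewrite ?addn1 ?addn0.
  rewrite expo_sum big_split /= De (bigD1 i) //= eqxx big1 ?addn1 // => j /negPf.
  by move->.
rewrite (bigD1 i) //= -Eb eqxx /sqbin leq_addr addKn bin1 big1 => [|j /negPf ji].
  rewrite mulr1 F2_natr; case: (boolP (odd (e i))) => oi.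
    rewrite (bigD1 i) //= big1 => [|i' /andP[_ /negPf ni]].
      by rewrite addr0 xpowE (introT forallP) // => j; rewrite Eb.
    rewrite xpowE; case: forallP => // /(_ i)/eqP; rewrite -Eb eqxx eq_sym ni; lia.
  rewrite big1 // => i' oi'; rewrite xpowE; case: forallP => // /(_ i)/eqP.
  rewrite -Eb eqxx; case: eqP => [ii'|]; last by lia.
  by rewrite -ii' (negPf oi) in oi'.
by rewrite -Eb ji addn0 leqnn subnn bin0.
Qed.

End Squares.

(** * Telescoping and the map [f |-> x^p * f ^ 2] *)

Section Lifting.
Variable k : nat.
Implicit Types (d m : nat) (e u : 'I_k -> nat) (p : pred 'I_k).

(* The polynomial [x_i ^ (2 ^ s) * x ^ e] squares to [A s + A s.+1], where
   [A s] is [x_i ^ (2 ^ s)] times the component of [Sq (x ^ e)] of the right degree. *)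
Lemma linear_times_square_hit n m i e :
  (2 ^ n < m.+1 < 2 ^ n.+1)%N -> (\sum_j e j = m)%N ->
  xpow (m + m).+1 (fun j => (e j + e j + (j == i))%N) \in hit k (m + m).+1.
Proof.
move=> /andP[lt_nm lt_mn] De; set d := (m + m).+1.
pose u s j := (e j + (j == i) * 2 ^ s)%N.
pose A s : Pd k d := [ffun b => \prod_j sqbin (e j) (u s j) (expo b j)].
have Du s : (\sum_j u s j = m + 2 ^ s)%N.
  rewrite big_split /= De (bigD1 i) //= eqxx mul1n big1 ?addn0 // => j /negPf.
  by move->.
have SqA s : Sq d (xpow (m + 2 ^ s) (u s)) = A s + A s.+1.
  apply/ffunP => b; rewrite Sq_xpow // [RHS]PdD !ffunE (bigD1 i) //= /u eqxx mul1n.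
  rewrite [X in sqbin X]addnC sqbin_pow2 mulrDl -addnA addnn -mul2n -expnS.
  congr (_ + _); rewrite [RHS](bigD1 i) //= eqxx mul1n; congr (_ * _);
    by apply: eq_bigr => j /negPf ->; rewrite !addn0.
have A0 : A 0%N = xpow d (fun j => (e j + e j + (j == i))%N).
  transitivity (xpow d (fun j => e j + u 0 j)%N).
    by apply/ffunP => b; rewrite [LHS]ffunE top_square // big_split /= De Du addnA addn1.
  by apply: eq_xpow => j; rewrite /u muln1 addnA.
(* Every term of [A n.+1] is divisible by a monomial of degree $m+2^{n+1}$, which exceeds $2m+1$ by
   the upper bound on [m.+1]. *)
have An : A n.+1 = 0.
  apply/ffunP => b; rewrite !ffunE.
  case: (boolP [forall j, u n.+1 j <= expo b j]%N) => [/forallP le_ub|].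
    suff: (m + 2 ^ n.+1 <= d)%N by rewrite /d; lia.
    rewrite -(Du n.+1) -[X in (_ <= X)%N](expo_sum b).
    by apply: leq_sum => j _; apply: le_ub.
  rewrite negb_forall => /existsP[j /negPf lt_bu].
  by apply: (@prodF2_0 _ _ j); rewrite /sqbin lt_bu.
rewrite -A0.
have: forall s, (s <= n.+1)%N -> A 0%N - A s \in hit k d.
  elim=> [|s IHs] lt_sn; first by rewrite subrr mem0v.
  have ->: A 0%N - A s.+1 = A 0%N - A s + (A s + A s.+1) - (A s.+1 + A s.+1).
    by rewrite addrA subrK opprD addrA addrK.
  rewrite -SqA; apply: rpredB; first apply: rpredD.
  - by apply: IHs; apply: ltnW.
  (* The lower bound on [m.+1] gives $m+2^s<2m+1$ for $s\le n$, so the square has positive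
     degree. *)
  - apply: Sq_hit; have: (2 ^ s <= 2 ^ n)%N by rewrite leq_exp2l.
    by rewrite /d; lia.
  by rewrite Pd_addxx rpred0.
by move/(_ n.+1 (leqnn _)); rewrite An subr0.
Qed.

(* [x^p * f ^ 2] *)
Definition phi d m p (f : Pd k m) : Pd k d :=
  [ffun b => if [forall j, odd (expo b j) == p j]
             then \sum_(a : mon k m | [forall j, expo a j == (expo b j)./2]) f a else 0].

Fact phi_is_linear d m p : linear (@phi d m p).
Proof.
move=> c f g; apply/ffunP => b; rewrite [LHS]ffunE [RHS]PdD [in RHS]PdZ.
rewrite [phi _ p f b]ffunE [phi _ p g b]ffunE; case: ifP; last by rewrite mulr0 addr0.
by move=> _; rewrite mulr_sumr -big_split; apply: eq_bigr => a _; rewrite PdD PdZ.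
Qed.
HB.instance Definition _ d m p :=
  GRing.isLinear.Build F2 (Pd k m) (Pd k d) _ (@phi d m p) (@phi_is_linear d m p).

Lemma sum_expo_eq m (f : Pd k m) (a0 : mon k m) e : expo a0 =1 e ->
  \sum_(a : mon k m | [forall j, expo a j == e j]) f a = f a0.
Proof.
move=> E; rewrite (eq_bigl (pred1 a0)) ?big_pred1_eq // => a /=.
rewrite -[RHS](expo_eqE a0 a).
by apply: eq_forallb => j; rewrite E.
Qed.

(** The halved exponents form an element of [mon k m] only once their degree is known to be [m],
    hence the existential form. *)
Lemma phiE d m p (f : Pd k m) (b : mon k d) : d = (\sum_j p j + m.*2)%N ->
  (forall j, odd (expo b j) = p j) ->
  exists2 b' : mon k m, expo b' =1 halfe (expo b) & phi d p f b = f b'.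
Proof.
move=> Dd pb; have Dh : (\sum_j halfe (expo b) j = m)%N.
  have := deg_half (expo b); rewrite expo_sum wt0E.
  under eq_bigr => j do rewrite pb.
  by rewrite {1}Dd => /eqP; rewrite eqn_add2l => /eqP/double_inj.
have [b' Eb'] := expo_exists Dh; exists b' => //.
rewrite ffunE (introT forallP) => [|j]; last by rewrite pb.
exact: sum_expo_eq.
Qed.

Lemma phi_out d m p (f : Pd k m) (b : mon k d) j : odd (expo b j) != p j -> phi d p f b = 0.
Proof.
move=> npb; rewrite ffunE; case: forallP => // /(_ j).
by rewrite (negPf npb).
Qed.

Lemma phi_xpow d m p e : d = (\sum_j p j + m.*2)%N ->
  phi d p (xpow m e) = xpow d (fun j => (p j + (e j).*2)%N).
Proof.
move=> Dd; apply/ffunP => b; rewrite [RHS]xpowE.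
case: (boolP [forall j, odd (expo b j) == p j]) => [/forallP pb|].
  have [b' Eb' ->] := phiE (xpow m e) Dd (fun j => eqP (pb j)).
  rewrite xpowE; congr (nat_of_bool _)%:R; apply: eq_forallb => j.
  by rewrite Eb' /halfe -[in RHS](odd_double_half (expo b j)) (eqP (pb j)) eqn_add2l; lia.
rewrite negb_forall => /existsP[j npb]; rewrite (phi_out _ npb).
case: forallP => // /(_ j)/eqP Eb; move: npb; rewrite Eb oddD odd_double addbF.
by case: (p j).
Qed.

(* [Sq (x^p * g ^ 2)] is [x^p * (Sq g) ^ 2] plus terms in which some variable of [x^p]
   got squared. *)
Lemma phi_hit d m p f : d = (\sum_j p j + m.*2)%N -> f \in hit k m ->
  phi d p f \in (hit k d + mspan (fun b : mon k d => wt 0 (expo b) < \sum_j p j)%N)%VS.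
Proof.
move=> Dd; rewrite -[phi d p f](lfunE (@phi d m p)) memv_preim; apply: subvP.
apply: hit_subv => n a lt_nm; rewrite -memv_preim lfunE /=.
pose g := xpow (\sum_j p j + n.*2)%N (fun j => p j + (expo a j).*2)%N.
have Dg : (\sum_j (p j + (expo a j).*2) = \sum_j p j + n.*2)%N.
  rewrite big_split -[in RHS](expo_sum a) -mul2n big_distrr; congr (_ + _)%N.
  by apply: eq_bigr => j _; rewrite /= mul2n.
rewrite -(subrK (Sq d g) (phi _ _ _)) addrC; apply: memv_add.
  by apply: Sq_hit; rewrite Dd; lia.
apply: mem_mspan => b; rewrite [X in X != 0]PdD.
rewrite [X in _ + X]ffunE Sq_xpow //.
(* On monomials with parity pattern [p] the coefficients agree by [sqbin_half]. Any other monomial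
   in [Sq d g] must be shown to have fewer odd exponents than [p]. *)
case: (boolP [forall j, odd (expo b j) == p j]) => [/forallP pb|npb].
  have [b' Eb' ->] := phiE (Sq m (monom a)) Dd (fun j => eqP (pb j)).
  rewrite Sq_monom (eq_bigr (fun j =>
    sqbin (p j + (expo a j).*2) (p j + (expo a j).*2) (expo b j))).
    by rewrite subrr eqxx.
  move=> j _; rewrite Eb' [RHS]sqbin_half.
    by congr (sqbin _ _ _); rewrite half_bit_double.
  by rewrite oddD odd_double addbF (eqP (pb j)); case: (p j).
have [j npj] : exists j, odd (expo b j) != p j by apply/existsP; rewrite -negb_forall.
rewrite (phi_out _ npj) sub0r oppr_eq0 ltnNge => nz; apply/negP => ge_b.
(* Odd exponents of [b] occur only inside [p]; if there were at least as many as in [p], the two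
   patterns would coincide. *)
have le_p i : (odd (expo b i) <= p i)%N.
  rewrite leqNgt; apply: contraNN nz => lt_p; apply/eqP.
  apply: (@prodF2_0 _ _ i); apply: sqbin_odd; last by move: lt_p; case: odd; case: (p i).
  by rewrite oddD odd_double addbF; move: lt_p; case: odd; case: (p i).
case/negP: npj; suff /(_ j): (fun j => odd (expo b j) : nat) =1 (fun j => p j : nat).
  by case: odd; case: (p j).
apply: eq_leq_sum => //; apply/eqP; rewrite eqn_leq leq_sum //.
by rewrite wt0E in ge_b.
Qed.

End Lifting.

(** * Monomials of low weight are hit *)

Section Weights.
Variable k : nat.
Implicit Types (d m n : nat) (e u : 'I_k -> nat) (p : pred 'I_k).

Lemma odd_wt0 e d : (\sum_j e j)%N = d -> odd (wt 0 e) = odd d.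
Proof. by move=> <-; rewrite deg_half oddD odd_double addbF. Qed.

Lemma eq_xpow_mem d e1 e2 (V : {vspace Pd k d}) : e1 =1 e2 -> xpow d e2 \in V -> xpow d e1 \in V.
Proof. by move=> /eq_xpow ->. Qed.

Lemma xpow_phi d m e : d = (wt 0 e + m.*2)%N ->
  xpow d e = phi d (fun j => odd (e j)) (xpow m (halfe e)).
Proof.
move=> Dd; rewrite phi_xpow -?wt0E //.
by apply: eq_xpow => j; rewrite odd_double_half.
Qed.

(** A single odd exponent means $x_iy^2$ with $y$ of degree [m]. The bounds say that $m+1$ is not a
    power of two. *)
Lemma wt1_hit n m d e : (2 ^ n < m.+1 < 2 ^ n.+1)%N -> d = m.*2.+1 ->
  (\sum_j e j)%N = d -> wt 0 e = 1%N -> xpow d e \in hit k d.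
Proof.
move=> lt_m -> De We; have [i pi oddi]: exists2 i, odd (e i) & forall j, j != i -> ~~ odd (e j).
  case: (boolP [exists i, odd (e i)]) => [/existsP[i oi]|].
    exists i => // j ji; apply/negP => oj; move: We; rewrite wt0E (bigD1 i) //= oi.
    by rewrite (bigD1 j) //= oj; lia.
  rewrite negb_exists => /forallP no; move: We; rewrite wt0E big1 // => i _.
  by rewrite (negPf (no i)).
have Dh : (\sum_j halfe e j = m)%N by have := deg_half e; rewrite De We; lia.
rewrite -addnn; apply: eq_xpow_mem (linear_times_square_hit i lt_m Dh) => j.
rewrite -{1}(odd_double_half (e j)) addnC addnn; congr (_ + _)%N.
by case: eqP => [->|/eqP/oddi/negPf ->]; rewrite ?pi.
Qed.

Lemma wt0_hit d m e : d = (m + m)%N -> (0 < m)%N -> (\sum_j e j)%N = d -> wt 0 e = 0%N ->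
  xpow d e \in hit k d.
Proof.
move=> -> m_gt0 De We.
have Dh : (\sum_j halfe e j = m)%N by have := deg_half e; rewrite De We; lia.
apply: eq_xpow_mem (square_hit m_gt0 Dh) => j; rewrite addnn -{1}(odd_double_half (e j)).
by move/eqP: We; rewrite wt0E sum_nat_eq0 => /forallP/(_ j)/=; case: odd.
Qed.

(* The error term of [phi_hit] has weight 1, hence is hit. *)
Lemma phi_hit3 n m d p f : (2 ^ n < m.+2 < 2 ^ n.+1)%N -> d = (3 + m.*2)%N ->
  (\sum_j p j = 3)%N -> f \in hit k m -> phi d p f \in hit k d.
Proof.
move=> lt_m Dd Dp /(phi_hit (d := d) (p := p)); rewrite Dp => /(_ Dd).
apply: subvP; rewrite subv_add subvv /=; apply: mspan_subv => b lt_b.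
(* Since $3+2m=2(m+1)+1$, [wt1_hit] is used at $m+1$, whence the bounds on [m.+2]. *)
rewrite monom_xpow; apply: wt1_hit lt_m _ (expo_sum b) _; first by rewrite Dd; lia.
have od : odd d by rewrite Dd oddD odd_double.
by move: (odd_wt0 (expo_sum b)) lt_b; rewrite od; case: wt => [|[|[|]]].
Qed.

Lemma wt3_hit n m d e : (2 ^ n < m.+2 < 2 ^ n.+1)%N -> d = (3 + m.*2)%N -> wt 0 e = 3%N ->
  xpow m (halfe e) \in hit k m -> xpow d e \in hit k d.
Proof.
move=> lt_m Dd We; rewrite (@xpow_phi d m) ?We //.
by apply: phi_hit3 lt_m Dd _; rewrite -wt0E.
Qed.

Lemma deg_halfe d m w e : (\sum_j e j)%N = d -> d = (w + m.*2)%N -> wt 0 e = w ->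
  (\sum_j halfe e j)%N = m.
Proof. by move=> De Dd We; have := deg_half e; rewrite De We; lia. Qed.

Lemma low4_hit e : (\sum_j e j = 4)%N -> (wt 0 e < 2)%N -> xpow 4 e \in hit k 4.
Proof.
move=> De lt_e; apply: (@wt0_hit _ 2) => //.
by move: (odd_wt0 De) lt_e; case: wt => [|[|]].
Qed.

(** In odd degree $\omega_1$ is odd, so 0 and 2 are excluded; [P] stands for the condition on the
    later weights. *)
Lemma low_odd d e (P : bool) : (\sum_j e j)%N = d -> odd d ->
  (wt 0 e < 3)%N || (wt 0 e == 3%N) && P -> wt 0 e = 1%N \/ wt 0 e = 3%N /\ P.
Proof.
move=> De od; move: (odd_wt0 De); rewrite od.
by case: wt => [|[|[|[|x]]]] //=; [left|right].
Qed.

Lemma low11_hit e : (\sum_j e j = 11)%N ->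
  (wt 0 e < 3)%N || (wt 0 e == 3%N) && (wt 1 e < 2)%N -> xpow 11 e \in hit k 11.
Proof.
(* Here $11=2\cdot5+1=3+2\cdot4$ and $4<6<8$. The next two lemmas use $25=3+2\cdot11$ with $8<13<16$
   and $53=3+2\cdot25$ with $16<27<32$. *)
move=> De /(low_odd De isT)[We|[We]]; first exact: (@wt1_hit 2 5).
move=> lt_e; apply: (@wt3_hit 2 4) => //; apply: low4_hit; first exact: (deg_halfe De _ We).
by rewrite -wtS.
Qed.

Lemma low25_hit e : (\sum_j e j = 25)%N ->
  (wt 0 e < 3)%N || (wt 0 e == 3%N) && ((wt 1 e < 3)%N || (wt 1 e == 3%N) && (wt 2 e < 2)%N) ->
  xpow 25 e \in hit k 25.
Proof.
move=> De /(low_odd De isT)[We|[We]]; first exact: (@wt1_hit 3 12).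
move=> lt_e; apply: (@wt3_hit 3 11) => //; apply: low11_hit; first exact: (deg_halfe De _ We).
by rewrite -!wtS.
Qed.

Lemma low53_hit e : (\sum_j e j = 53)%N ->
  (wt 0 e < 3)%N || (wt 0 e == 3%N) && ((wt 1 e < 3)%N || (wt 1 e == 3%N) &&
    ((wt 2 e < 3)%N || (wt 2 e == 3%N) && (wt 3 e < 2)%N)) ->
  xpow 53 e \in hit k 53.
Proof.
move=> De /(low_odd De isT)[We|[We]]; first exact: (@wt1_hit 4 26).
move=> lt_e; apply: (@wt3_hit 4 25) => //; apply: low25_hit; first exact: (deg_halfe De _ We).
by rewrite -!wtS.
Qed.

End Weights.

(** * Weight (3,3,4) in degree 25 *)

Section Reorder.
Variable s : 'S_5.
Implicit Types (l a : seq nat).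

(** Exponents as lists make relations computable; [s] transports a relation found for sorted
    exponents to any order of the variables. *)
Definition xpowl d l : Pd 5 d := xpow d (fun j => nth 0%N l (s j)).

Lemma sum_nth_perm (F : nat -> nat) l : size l = 5%N ->
  (\sum_(j < 5) F (nth 0%N l (s j)) = sumn [seq F x | x <- l])%N.
Proof.
move=> Sl; transitivity (\sum_(j < 5) F (nth 0%N l j))%N.
  by rewrite [RHS](reindex_inj (h := s) perm_inj).
by rewrite sumnE big_map (big_nth 0%N) Sl big_mkord.
Qed.

Definition wtl i l := sumn [seq nat_of_bool (odd (x %/ 2 ^ i)) | x <- l].

Lemma wtlE i l : size l = 5%N -> wt i (fun j => nth 0%N l (s j)) = wtl i l.
Proof. exact: (sum_nth_perm (fun x => odd (x %/ 2 ^ i) : nat)). Qed.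

Lemma degl l : size l = 5%N -> (\sum_(j < 5) nth 0%N l (s j))%N = sumn l.
Proof. by move=> Sl; rewrite (sum_nth_perm id Sl) map_id. Qed.

(* The exponents of the monomials of [Sq^1 (x ^ l)]. *)
Definition sq1 l := [seq incr_nth l i | i <- iota 0 5 & odd (nth 0%N l i)].

Lemma sq1_hit d l : size l = 5%N -> sumn l = d ->
  \sum_(t <- sq1 l) xpowl d.+1 t \in hit 5 d.+1.
Proof.
move=> Sl Dl; have De := degl Sl; rewrite Dl in De.
suff ->: \sum_(t <- sq1 l) xpowl d.+1 t = Sq d.+1 (xpowl d l) by apply: Sq_hit.
rewrite Sq1_xpow // big_map big_filter -[iota 0 5]/(index_iota 0 5) big_mkord.
rewrite (reindex_inj (h := s) perm_inj) /=; apply: eq_bigr => i _.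
apply: eq_xpow => j; rewrite nth_incr_nth addnC; congr (_ + _)%N.
by rewrite (inj_eq val_inj) (inj_eq perm_inj) eq_sym.
Qed.

Definition lift a l := [seq (x.1 + x.2.*2)%N | x <- zip a l].

Lemma phi_xpowl a l m d : size a = 5%N -> size l = 5%N -> all (fun x => x < 2)%N a ->
  d = (sumn a + m.*2)%N ->
  phi d (fun j => nth 0%N a (s j) == 1%N) (xpowl m l) = xpowl d (lift a l).
Proof.
move=> Sa Sl /all_nthP lt_a Dd.
have Ea j : (nth 0 a (s j) == 1 :> nat) = nth 0%N a (s j) :> nat.
  by have := lt_a 0%N (s j); rewrite Sa => /(_ (ltn_ord _)); case: (nth _ _ _) => [|[|]].
rewrite phi_xpow; last by rewrite (eq_bigr _ (fun j _ => Ea j)) degl.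
apply: eq_xpow => j; rewrite Ea (nth_map (0%N, 0%N)) ?nth_zip ?Sa ?Sl //.
by rewrite size_zip Sa Sl ltn_ord.
Qed.

(** In degree 25 the weights 3, 3, 2 force $(3,3,2,1)$, which is $(3,3,3,2,1)$ with its first entry
    peeled off. *)
Definition S25 : {vspace Pd 5 25} :=
  (hit 5 25 + mspan (fun b : mon 5 25 =>
     [&& wt 0 (expo b) == 3, wt 1 (expo b) == 3 & wt 2 (expo b) == 2]%N))%VS.

Lemma hit_S25 f : f \in hit 5 25 -> f \in S25.
Proof. exact/subvP/addvSl. Qed.

Lemma low_S25 (e : 'I_5 -> nat) : (\sum_j e j = 25)%N ->
  (wt 0 e < 3)%N || (wt 0 e == 3%N) && ((wt 1 e < 3)%N || (wt 1 e == 3%N) && (wt 2 e < 4)%N) ->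
  xpow 25 e \in S25.
Proof.
move=> De lt_e.
case: (boolP ((wt 0 e < 3) || (wt 0 e == 3) && ((wt 1 e < 3) || (wt 1 e == 3) && (wt 2 e < 2)))%N).
  by move/(low25_hit De)/hit_S25.
move=> ge_e.
have /and3P[/eqP W0 /eqP W1 W2]: [&& wt 0 e == 3, wt 1 e == 3 & 2 <= wt 2 e < 4]%N.
  move: lt_e ge_e; case: (ltngtP (wt 0 e) 3) => //= _.
  by case: (ltngtP (wt 1 e) 3) => //= _ -> ; rewrite -leqNgt => ->.
have D1 : (\sum_j halfe e j = 11)%N by apply: (deg_halfe De _ W0).
rewrite wtS in W1.
have D2 : (\sum_j halfe (halfe e) j = 4)%N by apply: (deg_halfe D1 _ W1).
(* Two halvings leave degree 4, so the third weight is even. *)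
have/eqP W2': wt 2 e == 2%N.
  rewrite !wtS in W2 *; move: (odd_wt0 D2) W2.
  by case: (wt 0 _) => [|[|[|[|]]]].
have [b Eb] := expo_exists De.
apply: (subvP (addvSr _ _)); rewrite -(eq_xpow _ Eb) -monom_xpow; apply: monom_mspan.
by rewrite !(eq_wt _ Eb) W0 W2' wtS W1.
Qed.

Definition low l := [&& size l == 5, sumn l == 25 & (wtl 0 l < 3) ||
  (wtl 0 l == 3) && ((wtl 1 l < 3) || (wtl 1 l == 3) && (wtl 2 l < 4))]%N.

Lemma low_xpowl l : low l -> xpowl 25 l \in S25.
Proof.
case/and3P => /eqP Sl /eqP Dl lt_l; apply: low_S25; first by rewrite degl.
by rewrite !wtlE.
Qed.

(** [(c1, c2)] stands for the relations [Sq^1 (x ^ l)] for [l] in [c1] and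
    [phi a (Sq^1 (x ^ l))] for [(a, l)] in [c2]. *)
Definition relations := (seq (seq nat) * seq (seq nat * seq nat))%type.

(** The degrees 24 and 10 become 25 and 11 under $Sq^1$, and $25=3+2\cdot11$ with the 3 coming from
    the square-free factor [al.1]. *)
Definition wf (c : relations) :=
  all (fun l => (size l == 5) && (sumn l == 24))%N c.1 &&
  all (fun al => [&& size al.1 == 5, size al.2 == 5, all (fun x => x < 2) al.1,
                     sumn al.1 == 3 & sumn al.2 == 10])%N c.2.

Definition terms (c : relations) :=
  flatten [seq sq1 l | l <- c.1] ++ flatten [seq [seq lift al.1 t | t <- sq1 al.2] | al <- c.2].

Lemma size_sq1 l t : size l = 5%N -> t \in sq1 l -> size t = 5%N.
Proof.
move=> Sl /mapP[i]; rewrite mem_filter mem_iota => /andP[_ /andP[_ lt_i]] ->.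
by rewrite size_incr_nth Sl lt_i.
Qed.

Lemma terms_S25 c : wf c -> \sum_(t <- terms c) xpowl 25 t \in S25.
Proof.
case/andP => /allP wf1 /allP wf2; rewrite big_cat /=.
rewrite !big_flatten !big_map /=; apply: rpredD; rewrite big_seq; apply: rpred_sum.
  by move=> l /wf1/andP[/eqP Sl /eqP Dl]; apply/hit_S25/sq1_hit.
case=> a l /wf2/and5P[/= /eqP Sa /eqP Sl lt_a /eqP Da /eqP Dl]; apply: hit_S25.
rewrite big_map big_seq.
have D25 : (25 = sumn a + 11.*2)%N by rewrite Da.
rewrite (eq_bigr (fun t => phi 25 (fun j => nth 0%N a (s j) == 1%N) (xpowl 11 t))); last first.
  by move=> t /(size_sq1 Sl) St; rewrite (phi_xpowl Sa St lt_a D25).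
rewrite -big_seq -linear_sum; apply: (@phi_hit3 _ 3 11) => //; last exact: sq1_hit.
rewrite -[RHS]Da -(degl Sa); apply: eq_bigr => j _.
have/all_nthP lt_a' := lt_a; have := lt_a' 0%N (s j).
by rewrite Sa => /(_ (ltn_ord _)); case: (nth _ _ _) => [|[|]].
Qed.

(** As [t] is counted along with the relations, even multiplicity means cancellation over $\mathbb
    F_2$. *)
Definition check t (c : relations) :=
  wf c && (let r := t :: terms c in all (fun x => low x || ~~ odd (count_mem x r)) r).

(* Modulo [S25] only the terms of weight (3,3,4) matter, and they cancel in
   pairs, except for [t]. *)
Lemma check_S25 t c : check t c -> xpowl 25 t \in S25.
Proof.
case/andP => /terms_S25 Sc /allP Er.
have: \sum_(x <- t :: terms c) xpowl 25 x \in S25.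
  rewrite -big_undup_iterop_count big_seq; apply: rpred_sum => x; rewrite mem_undup => /Er.
  set n := count_mem _ _; rewrite -[iterop _ _ _ _]/(xpowl 25 x *+ n).
  case/orP => [/low_xpowl Sx|even_n]; first exact: rpredMn.
  rewrite -(odd_double_half n) (negPf even_n) add0n -mul2n mulrnA mulr2n Pd_addxx.
  by rewrite mul0rn rpred0.
by rewrite big_cons rpredDr.
Qed.

End Reorder.

(* The nine sorted exponent vectors of weight (3,3,4), each with relations found by a
   computer search. *)
Definition certificates : seq (seq nat * relations) := [::
  ([:: 0; 4; 7; 7; 7], ([:: [:: 0; 3; 7; 7; 7]], [::]));
  ([:: 0; 5; 6; 7; 7], ([::], [:: ([:: 0; 1; 0; 1; 1], [:: 0; 1; 3; 3; 3])]));
  ([:: 1; 4; 6; 7; 7], ([::], [:: ([:: 1; 0; 0; 1; 1], [:: 0; 1; 3; 3; 3])]));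
  ([:: 1; 5; 6; 6; 7], ([::], [:: ([:: 1; 1; 0; 0; 1], [:: 0; 1; 3; 3; 3])]));
  ([:: 2; 4; 5; 7; 7], ([:: [:: 1; 4; 5; 7; 7]],
    [:: ([:: 1; 0; 0; 1; 1], [:: 0; 1; 3; 3; 3])]));
  ([:: 2; 5; 5; 6; 7], ([:: [:: 1; 5; 5; 6; 7]],
    [:: ([:: 1; 1; 0; 0; 1], [:: 0; 1; 3; 3; 3]); ([:: 1; 0; 1; 0; 1], [:: 0; 3; 1; 3; 3])]));
  ([:: 3; 4; 4; 7; 7], ([:: [:: 5; 1; 4; 7; 7]],
    [:: ([:: 1; 0; 0; 1; 1], [:: 1; 1; 2; 3; 3]); ([:: 0; 1; 0; 1; 1], [:: 3; 0; 1; 3; 3])]));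
  ([:: 3; 4; 5; 6; 7], ([:: [:: 5; 1; 5; 6; 7]],
    [:: ([:: 1; 0; 1; 0; 1], [:: 1; 1; 2; 3; 3]); ([:: 0; 1; 1; 0; 1], [:: 3; 0; 1; 3; 3]);
        ([:: 1; 1; 0; 0; 1], [:: 1; 0; 3; 3; 3])]));
  ([:: 3; 5; 5; 6; 6], ([:: [:: 3; 5; 5; 5; 6]; [:: 5; 3; 5; 5; 6]; [:: 5; 5; 3; 5; 6]],
    [:: ([:: 1; 1; 0; 1; 0], [:: 1; 1; 3; 2; 3]); ([:: 1; 0; 1; 1; 0], [:: 1; 3; 1; 2; 3]);
        ([:: 1; 1; 1; 0; 0], [:: 2; 1; 1; 3; 3]); ([:: 0; 1; 1; 1; 0], [:: 3; 1; 1; 2; 3])]))].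

Lemma certificatesP : all (fun tc => check tc.1 tc.2) certificates.
Proof. by vm_compute. Qed.

Definition certified l :=
  [&& sorted leq l, sumn l == 25, wtl 0 l == 3, wtl 1 l == 3 & wtl 2 l == 4]%N
  ==> (l \in unzip1 certificates).

Lemma certified_lt8 : all (fun a => all (fun b => all (fun c => all (fun d => all (fun e =>
  certified [:: a; b; c; d; e])
  (iota 0 8)) (iota 0 8)) (iota 0 8)) (iota 0 8)) (iota 0 8).
Proof. by vm_compute. Qed.

Lemma certificates_complete l :
  size l = 5%N -> all (fun x => x < 8)%N l -> sorted leq l -> sumn l = 25%N ->
  wtl 0 l = 3%N -> wtl 1 l = 3%N -> wtl 2 l = 4%N -> l \in unzip1 certificates.
Proof.
move=> Sl lt_l So Su W0 W1 W2.
suff: certified l by rewrite /certified So Su W0 W1 W2.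
case: l Sl lt_l {So Su W0 W1 W2} => [|a [|b [|c [|d [|e [|x l]]]]]] // _.
case/and5P => lt_a lt_b lt_c lt_d /andP[lt_e _].
have inI x : (x < 8)%N -> x \in iota 0 8 by rewrite mem_iota.
move/allP: certified_lt8 => /(_ a (inI _ lt_a))/allP/(_ b (inI _ lt_b))/allP.
by move=> /(_ c (inI _ lt_c))/allP/(_ d (inI _ lt_d))/allP/(_ e (inI _ lt_e)).
Qed.

Lemma top_S25 (e : 'I_5 -> nat) : (\sum_j e j = 25)%N ->
  wt 0 e = 3%N -> wt 1 e = 3%N -> wt 2 e = 4%N -> xpow 25 e \in S25.
Proof.
move=> De W0 W1 W2; pose t := [tuple e j | j < 5]; pose l := sort leq t.
have Sl : size l == 5%N by rewrite size_sort size_tuple.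
have /tuple_permP[s Es] : perm_eq t (Tuple Sl) by rewrite perm_sym perm_sort.
have Ee j : e j = nth 0%N l (s j).
  transitivity (tnth t j); first by rewrite tnth_mktuple.
  rewrite (tnth_nth 0%N) Es -tnth_nth tnth_mktuple (tnth_nth 0%N) //.
have Hl := eqP Sl.
have D1 : (\sum_j halfe e j = 11)%N by apply: (deg_halfe De _ W0).
rewrite wtS in W1.
have D2 : (\sum_j halfe (halfe e) j = 4)%N by apply: (deg_halfe D1 _ W1).
rewrite !wtS in W2.
have D3 : (\sum_j halfe (halfe (halfe e)) j = 0)%N by apply: (deg_halfe D2 _ W2).
(* The weights 3, 3, 4 exhaust the degree, $3+6+16=25$, so all higher binary digits vanish. This
   makes the enumeration finite and small. *)
have lt_e j : (e j < 8)%N.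
  by move/eqP: D3; rewrite sum_nat_eq0 => /forallP/(_ j) /=; rewrite /halfe; lia.
have: l \in unzip1 certificates.
  apply: certificates_complete => //.
  - by rewrite all_sort; apply/allP => _ /mapP[j _ ->].
  - by apply: sort_sorted; apply: leq_total.
  - by rewrite -(degl s Hl) -[RHS]De; apply: eq_bigr => j _; rewrite Ee.
  - by rewrite -(wtlE s _ Hl) -[RHS]W0; apply: eq_wt => j; rewrite Ee.
  - by rewrite -(wtlE s _ Hl) -[RHS]W1 -wtS; apply: eq_wt => j; rewrite Ee.
  - by rewrite -(wtlE s _ Hl) -[RHS]W2 -!wtS; apply: eq_wt => j; rewrite Ee.
case/mapP => tc /(allP certificatesP) ok_tc El; rewrite (eq_xpow _ Ee) El.
exact: check_S25 ok_tc.
Qed.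

(* If [e j] is [2] mod [4] then [Sq^1 (x / x_j)] is [x] plus monomials in which [x_j] and
   some other variable have dropped out of the second weight. *)
Lemma wt35_reduce d (e : 'I_5 -> nat) (V : {vspace Pd 5 d}) :
  (\sum_j e j = d)%N -> wt 0 e = 3%N -> wt 1 e = 5%N -> (hit 5 d <= V)%VS ->
  (forall u, (\sum_j u j = d)%N -> wt 0 u = 3%N -> wt 1 u = 3%N -> xpow d u \in V) ->
  xpow d e \in V.
Proof.
move=> De W0 W1 /subvP hitV IHu.
(* Five variables and second weight 5: every second binary digit is 1. *)
have odd2 j : odd (e j %/ 2 ^ 1).
  apply: contra_eqT W1 => /negPf ej; rewrite /wt (bigD1 j) //= ej add0n.
  rewrite ltn_eqF // -[X in (_ < X)%N](card_ord 5) -sum1_card [X in (_ < X)%N](bigD1 j) //=.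
  by rewrite add1n ltnS leq_sum // => i _; apply: leq_b1.
have [j ej]: exists j, ~~ odd (e j).
  apply/existsP; apply: contra_eqT W0; rewrite negb_exists => /forallP no.
  rewrite wt0E (eq_bigr (fun=> 1%N)) ?sum1_card ?card_ord // => j _.
  by have := no j; rewrite negbK => ->.
have ej_gt0 : (0 < e j)%N by have := odd2 j; case: (e j).
pose u i := (e i - (i == j))%N.
have uj : (fun i => (u i + (i == j))%N) =1 e.
  by move=> i; rewrite /u subnK //; case: eqP => [->|].
have sum_delta i : (\sum_(t < 5) (t == i) = 1)%N.
  by rewrite (bigD1 i) //= eqxx big1 // => t /negPf ->.
have Du : d = (\sum_i u i).+1.
  by rewrite -[LHS]De -(eq_bigr _ (fun i _ => uj i)) big_split /= sum_delta addn1.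
have odd_uj : odd (u j) by rewrite /u eqxx oddB // (negPf ej).
clear De; subst d; have SqU := Sq1_xpow (erefl (\sum_i u i)%N).
rewrite [RHS](bigD1 j) //= (eq_xpow _ uj) in SqU.
move/esym/(canRL (addrK _)): SqU => ->.
apply: rpredB; first exact/hitV/Sq_hit.
apply: rpred_sum => i /andP[odd_ui ne_ij].
have odd_ei : odd (e i) by move: odd_ui; rewrite /u (negPf ne_ij) subn0.
pose v t := (u t + (t == i))%N; apply: (IHu v).
- by rewrite big_split /= sum_delta addn1.
(* From [e] to [v], variable [i] stops being odd and variable [j] becomes odd. *)
- have: (\sum_t (odd (v t) + (t == i)) = \sum_t (odd (e t) + (t == j)))%N.
    apply: eq_bigr => t _; rewrite /v /u; case: (eqVneq t i) => [->|_].
      by rewrite (negPf ne_ij) subn0 oddD odd_ei.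
    case: (eqVneq t j) => [->|_]; last by rewrite subn0 !addn0.
    by rewrite !addn0 oddB // (negPf ej).
  by rewrite !big_split /= !sum_delta -!wt0E W0 => /addIn.
(* Modulo 4 the exponent of [i] goes from 3 to 0 and that of [j] from 2 to 1, so both second digits
   are lost. *)
have: (\sum_t (odd (v t %/ 2 ^ 1) + (t == i) + (t == j)) = \sum_t odd (e t %/ 2 ^ 1))%N.
  apply: eq_bigr => t _; have := odd2 t; rewrite /v /u; case: (eqVneq t i) => [->|_].
    by rewrite (negPf ne_ij); lia.
  by case: (eqVneq t j) => [->|_]; lia.
rewrite !big_split /= !sum_delta -/(wt 1 v) -/(wt 1 e) W1 -addnA.
by move/(@addIn 2 _ 3).
Qed.

(** * Degree 53 *)

Lemma odd_le5 w : odd w -> (w <= 5)%N -> [\/ w = 1%N, w = 3%N | w = 5%N].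
Proof. by case: w => [|[|[|[|[|[|?]]]]]] // _ _; constructor. Qed.

Lemma wt33_S25 (e : 'I_5 -> nat) : (\sum_j e j = 25)%N -> wt 0 e = 3%N -> wt 1 e = 3%N ->
  xpow 25 e \in S25.
Proof.
move=> De W0 W1; have D1 : (\sum_j halfe e j = 11)%N by apply: (deg_halfe De _ W0).
have W1' := W1; rewrite wtS in W1'.
have D2 : (\sum_j halfe (halfe e) j = 4)%N by apply: (deg_halfe D1 _ W1').
have [lt_W2|ge_W2] := ltnP (wt 2 e) 4; first by apply: low_S25; rewrite ?W0 ?W1.
apply: top_S25 => //; rewrite !wtS in ge_W2 *.
by move: (odd_wt0 D2) (wt_le 0 (halfe (halfe e))) ge_W2; case: wt => [|[|[|[|[|[|]]]]]].
Qed.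

Lemma wt3_S25 (e : 'I_5 -> nat) : (\sum_j e j = 25)%N -> wt 0 e = 3%N -> xpow 25 e \in S25.
Proof.
move=> De W0; have D1 : (\sum_j halfe e j = 11)%N by apply: (deg_halfe De _ W0).
have: odd (wt 1 e) by rewrite wtS (odd_wt0 D1).
case/odd_le5/(_ (wt_le _ _)) => W1.
- by apply: low_S25; rewrite ?W0 ?W1.
- exact: wt33_S25.
by apply: wt35_reduce W0 W1 _ _ => //; [exact: addvSl|exact: wt33_S25].
Qed.

Local Notation w53 := [:: 3; 3; 3; 2; 1]%N.

(** The truncated weight has $54=5+49$ entries; exposing five of them reduces the comparison with
    [w53] to a boolean formula. *)
Lemma omega53 k (b : mon k 53) : omega b =
  [:: wt 0 (expo b); wt 1 (expo b); wt 2 (expo b); wt 3 (expo b); wt 4 (expo b)]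
    ++ [seq wt i (expo b) | i <- iota 5 49].
Proof. by []. Qed.

Lemma padw53 : padw 54 w53 = w53 ++ nseq 49 0%N. Proof. by []. Qed.

Lemma lexlt_nseq0 s n : lexlt s (nseq n 0%N) = false.
Proof.
by elim: n s => [|n IHn] [|x s] //=; rewrite IHn andbF.
Qed.

Lemma lexlt_cons x s y t :
  lexlt (x :: s) (y :: t) = (x < y)%N || (x == y) && lexlt s t.
Proof. by []. Qed.

Lemma lexlt53 k (b : mon k 53) (e := expo b) : lexlt (omega b) (padw 54 w53) =
  (wt 0 e < 3)%N || (wt 0 e == 3%N) && ((wt 1 e < 3)%N || (wt 1 e == 3%N) &&
    ((wt 2 e < 3)%N || (wt 2 e == 3%N) && ((wt 3 e < 2)%N || (wt 3 e == 2%N) && (wt 4 e < 1)%N))).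
Proof. by rewrite omega53 padw53 !cat_cons !cat0s 5!lexlt_cons lexlt_nseq0 andbF orbF. Qed.

(** The first four weights account for $3+6+12+16=37$; the remaining 16 can only be $2^4\cdot1$. *)
Lemma wt53_tail k (e : 'I_k -> nat) : (\sum_j e j = 53)%N ->
  wt 0 e = 3%N -> wt 1 e = 3%N -> wt 2 e = 3%N -> wt 3 e = 2%N ->
  wt 4 e = 1%N /\ forall i, wt (5 + i) e = 0%N.
Proof.
rewrite !wtS => De W0 W1 W2 W3.
have D1 : (\sum_j halfe e j = 25)%N by apply: (deg_halfe De _ W0).
have D2 := deg_halfe (m := 11) (w := 3) D1 erefl W1.
have D3 := deg_halfe (m := 4) (w := 3) D2 erefl W2.
have D4 := deg_halfe (m := 1) (w := 2) D3 erefl W3.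
have W4 : wt 0 (halfe (halfe (halfe (halfe e)))) = 1%N.
  by move: (odd_wt0 D4) (deg_half (halfe (halfe (halfe (halfe e))))); rewrite D4; lia.
have D5 := deg_halfe (m := 0) (w := 1) D4 erefl W4.
split=> // i; rewrite !addSn add0n !wtS; apply: big1 => j _.
move/eqP: D5; rewrite sum_nat_eq0 => /forallP/(_ j)/eqP/= ->.
by rewrite div0n.
Qed.

Lemma Pw53 (b : mon 5 53) :
  wt 0 (expo b) = 3 -> wt 1 (expo b) = 3 -> wt 2 (expo b) = 3 -> wt 3 (expo b) = 2 ->
  omega b == padw 54 w53.
Proof.
move=> W0 W1 W2 W3; have [W4 Wi] := wt53_tail (expo_sum b) W0 W1 W2 W3.
rewrite omega53 padw53 W0 W1 W2 W3 W4; apply/eqP; congr (_ ++ _).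
apply: (@eq_from_nth _ 0%N); first by rewrite size_map size_iota size_nseq.
move=> i; rewrite size_map size_iota => lt_i.
by rewrite (nth_map 0%N) ?size_iota // nth_iota // Wi nth_nseq if_same.
Qed.

Definition S53 : {vspace Pd 5 53} := (hit 5 53 + Pw 5 53 w53)%VS.

Lemma hit_S53 f : f \in hit 5 53 -> f \in S53.
Proof. exact/subvP/addvSl. Qed.

Lemma Pw_S53 f : f \in Pw 5 53 w53 -> f \in S53.
Proof. exact/subvP/addvSr. Qed.

(** By [wt53_tail], a smaller weight already differs from $(3,3,3,2,1)$ in its first four entries,
    so [low53_hit] applies. *)
Lemma Pwminus_hit : (Pwminus 5 53 w53 <= hit 5 53)%VS.
Proof.
apply: mspan_subv => b; rewrite lexlt53 monom_xpow => lt_b; have De := expo_sum b.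
apply: low53_hit => //; case: ltngtP lt_b => //= W0; case: ltngtP => //= W1.
case: ltngtP => //= W2; case: ltngtP => //= W3.
by have [-> _] := wt53_tail De W0 W1 W2 W3.
Qed.

Lemma phi_S25 f (p : pred 'I_5) : (\sum_j p j = 3)%N -> f \in S25 -> phi 53 p f \in S53.
Proof.
move=> Dp /memv_addP[g hg [h Th ->]]; rewrite linearD; apply: rpredD.
  by apply: hit_S53; apply: (@phi_hit3 _ 4 25).
(* On the spanning monomials [phi 53 p] prefixes 3 to the weight: $(3,3,2)$ becomes $(3,3,3,2)$,
   which in degree 53 determines the rest. *)
suff /subvP/(_ h Th): (mspan (fun b : mon 5 25 =>
    [&& wt 0 (expo b) == 3, wt 1 (expo b) == 3 & wt 2 (expo b) == 2]%N) <=
    linfun (@phi 5 53 25 p) @^-1: S53)%VS by rewrite -memv_preim lfunE.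
apply: mspan_subv => b /and3P[/eqP W0 /eqP W1 /eqP W2].
rewrite -memv_preim lfunE /= monom_xpow phi_xpow ?Dp //.
set e := fun j => (p j + _)%N.
have De : (\sum_j e j = 53)%N.
  rewrite big_split /= Dp; under eq_bigr => j do rewrite -mul2n.
  by rewrite -big_distrr /= expo_sum.
have [a Ea] := expo_exists De; rewrite -(eq_xpow _ Ea) -monom_xpow.
have half_a : halfe (expo a) =1 expo b by move=> j; rewrite /halfe Ea half_bit_double.
have wt_a i : wt i.+1 (expo a) = wt i (expo b) by rewrite wtS (eq_wt _ half_a).
apply/Pw_S53/monom_mspan/orP; left; apply: Pw53; rewrite ?wt_a //.
rewrite (eq_wt _ Ea) wt0E -[RHS]Dp; apply: eq_bigr => j _.
by rewrite /e oddD odd_double addbF; case: (p j).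
Qed.

Lemma wt3_S53 (e : 'I_5 -> nat) : (\sum_j e j = 53)%N -> wt 0 e = 3%N -> xpow 53 e \in S53.
Proof.
have lift u : (\sum_j u j = 53)%N -> wt 0 u = 3%N -> wt 1 u = 3%N -> xpow 53 u \in S53.
  move=> Du W0 W1; rewrite (@xpow_phi _ _ 25) ?W0 //; apply: phi_S25.
    by rewrite -wt0E.
  apply: wt3_S25; first by apply: (deg_halfe Du _ W0).
  by rewrite -wtS.
move=> De W0; have D1 : (\sum_j halfe e j = 25)%N by apply: (deg_halfe De _ W0).
have: odd (wt 1 e) by rewrite wtS (odd_wt0 D1).
case/odd_le5/(_ (wt_le _ _)) => W1.
- by apply/hit_S53/low53_hit; rewrite ?W0 ?W1.
- exact: lift.
by apply: wt35_reduce W0 W1 _ _ => //; exact: addvSl.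
Qed.

Lemma wt_lt5_S53 : (mspan (fun b : mon 5 53 => wt 0 (expo b) < 5)%N <= S53)%VS.
Proof.
apply: mspan_subv => b lt_b; have De := expo_sum b.
case/odd_le5/(_ (wt_le _ _)): (odd_wt0 De) => W0; last by rewrite W0 in lt_b.
  by apply/Pw_S53/monom_mspan; rewrite lexlt53 W0 orbT.
by rewrite monom_xpow; apply: wt3_S53.
Qed.

(** With all variables in [p], [phi] is a section of [kam]: [f] minus the lift of [kam f] has no
    monomial with all exponents odd, and [phi_hit] handles the lift. *)
Lemma kam_reconstruct k m (f : Pd k (m.*2 + k)) : kam f \in hit k m ->
  f \in (hit k (m.*2 + k) + mspan (fun b : mon k (m.*2 + k) => wt 0 (expo b) < k)%N)%VS.
Proof.
have sumT : (\sum_(j < k) xpredT j)%N = k by rewrite sum1_card card_ord.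
have Dd : (m.*2 + k)%N = (\sum_(j < k) xpredT j + m.*2)%N by rewrite sumT addnC.
move=> /(phi_hit Dd); rewrite sumT => hit_phi.
rewrite -(subrK (phi (m.*2 + k) xpredT (kam f)) f) rpredD //.
apply: (subvP (addvSr _ _)); apply: mem_mspan => b; rewrite [X in X != 0]PdD.
rewrite [X in _ + X]ffunE; apply: contraR; rewrite -leqNgt => ge_b.
have odd_b j : odd (expo b j) = true.
  have le1 i : (odd (expo b i) <= 1)%N by apply: leq_b1.
  suff /(_ j): (fun i => odd (expo b i) : nat) =1 (fun=> 1%N) by case: odd.
  apply: eq_leq_sum => //; apply/eqP; rewrite eqn_leq leq_sum //=.
  by rewrite sum1_card card_ord -wt0E.
have [b' Eb' ->] := phiE (kam f) Dd odd_b.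
rewrite ffunE (@sum_expo_eq _ _ f b) ?subrr // => j.
by rewrite Eb' -[LHS]odd_double_half odd_b.
Qed.

(** This makes the induced map well defined: monomials with an even exponent contribute 0, and for
    $x=x_1\cdots x_ky^2$ the squares of $x$ are sent to squares of $y$. *)
Lemma kam_hit k m : (hit k (m.*2 + k) <= linfun (@kam k m) @^-1: hit k m)%VS.
Proof.
apply: hit_subv => n a lt_n; rewrite -memv_preim lfunE /=.
case: (boolP [forall j, odd (expo a j)]) => [/forallP odd_a|]; last first.
  rewrite negb_forall => /existsP[j even_j].
  suff ->: kam (Sq (m.*2 + k) (monom a)) = 0 by apply: rpred0.
  apply/ffunP => b; rewrite [LHS]ffunE [RHS]ffunE; apply: big1 => c /forallP Ec.
  rewrite Sq_monom; apply: (@prodF2_0 _ _ j); apply: sqbin_odd => //.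
  by rewrite (eqP (Ec j)) /= odd_double.
pose n' := (\sum_j halfe (expo a) j)%N.
have Dn : n = (k + n'.*2)%N.
  rewrite -[LHS](expo_sum a) deg_half wt0E; congr (_ + _)%N.
  by rewrite (eq_bigr (fun=> 1%N)) ?sum1_card ?card_ord // => j _; rewrite odd_a.
suff ->: kam (Sq (m.*2 + k) (monom a)) = Sq m (xpow n' (halfe (expo a))).
  by apply: Sq_hit; move: lt_n; rewrite {1}Dn; lia.
apply/ffunP => b; rewrite [LHS]ffunE Sq_xpow //.
have Db : (\sum_(j < k) (expo b j).*2.+1 = m.*2 + k)%N.
  under eq_bigr => j do rewrite -addn1 -mul2n.
  by rewrite big_split /= -big_distrr /= expo_sum mul2n sum1_card card_ord.
have [c Ec] := expo_exists Db; rewrite (sum_expo_eq _ Ec) Sq_monom.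
apply: eq_bigr => j _; rewrite sqbin_half ?Ec /= ?odd_double ?odd_a //.
by rewrite uphalf_double.
Qed.

(** * The kernel of Kameko's map *)

Lemma PplusP0 k d (a : mon k d) : Pplus_pred a = ~~ P0pred a.
Proof. by rewrite negb_exists. Qed.

Lemma proj_mspan k d (p : pred (mon k d)) (f : Pd k d) : proj p f \in mspan p.
Proof. by apply: mem_mspan => a; rewrite projE; case: (p a); rewrite ?eqxx. Qed.

Lemma proj_id k d (p : pred (mon k d)) (f : Pd k d) : f \in mspan p -> proj p f = f.
Proof.
move/mspanP => pf; apply/ffunP => a; rewrite projE; case: ifPn => // npa.
by apply/esym/eqP; apply: contraR npa => /pf.
Qed.

(** Squares preserve the set of variables dividing a monomial, so they respect the splitting
    $P_k=P_k^0\oplus P_k^+$. *)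
Lemma proj_Sq k m d (a : mon k m) :
  proj (@P0pred k d) (Sq d (monom a)) = if P0pred a then Sq d (monom a) else 0.
Proof.
apply/ffunP => b; rewrite projE; case: ifPn => [/existsP[j /eqP bj]|].
  case: ifPn => // /existsPn/(_ j) aj; rewrite [RHS]ffunE Sq_monom.
  by apply: (@prodF2_0 _ _ j); rewrite bj /sqbin leqn0 (negPf aj).
move/existsPn => b_gt0; case: ifPn => [/existsP[j /eqP aj]|_]; last by rewrite [RHS]ffunE.
rewrite Sq_monom; apply/esym/(@prodF2_0 _ _ j).
by rewrite aj sqbin0 eq_sym (negPf (b_gt0 j)).
Qed.

Lemma hit0_subv k d : (hit0 k d <= hit k d)%VS.
Proof. by apply/subv_sumP => e _; apply: (sumv_sup e) => //; rewrite limgS ?subvf. Qed.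

Lemma Sq_P0 k m d (f : Pd k m) : f \in P0 k m -> Sq d f \in P0 k d.
Proof.
suff /subvP PS: (P0 k m <= linfun (@Sq k m d) @^-1: P0 k d)%VS.
  by move/PS; rewrite -memv_preim lfunE.
apply: mspan_subv => a Pa; rewrite -memv_preim lfunE /=.
by have := proj_Sq d a; rewrite Pa => <-; apply: proj_mspan.
Qed.

Lemma hit0_P0 k d : (hit0 k d <= P0 k d)%VS.
Proof.
apply/subv_sumP => e _; apply/subvP => _ /memv_imgP[f Pf ->].
by rewrite lfunE; apply: Sq_P0.
Qed.

Lemma proj_hit k d (f : Pd k d) : f \in hit k d -> proj (@P0pred k d) f \in hit0 k d.
Proof.
suff /subvP PS: (hit k d <= linfun (proj (@P0pred k d)) @^-1: hit0 k d)%VS.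
  by move/PS; rewrite -memv_preim lfunE.
apply: hit_subv => m a lt_md; rewrite -memv_preim lfunE /= proj_Sq.
case: ifP => [Pa|_]; last exact: rpred0.
apply: (subvP (sumv_sup (Ordinal lt_md) isT (subvv _))).
by rewrite -(lfunE (@Sq k m d)) memv_img // monom_mspan.
Qed.

Lemma cap_P0_Pplus k d : (P0 k d :&: Pplus k d)%VS = 0%VS.
Proof.
apply/eqP; rewrite -subv0; apply/subvP => f /memv_capP[/mspanP P0f /mspanP Pf].
rewrite memv0; apply/eqP/ffunP => a; rewrite [RHS]ffunE; apply/eqP.
by apply: contraT => nz; have := Pf a nz; rewrite PplusP0 P0f.
Qed.

(** Projecting a hit sum $g+u$ to $P_k^0$ shows that $g$ is hit within $P_k^0$; then $u$ is hit as a
    difference. *)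
Lemma cap_hit_add k d (U : {vspace Pd k d}) : (U <= Pplus k d)%VS ->
  ((P0 k d + U) :&: hit k d)%VS = (hit0 k d + (U :&: hit k d))%VS.
Proof.
move=> /subvP UP; apply/eqP; rewrite eqEsubv; apply/andP; split; last first.
  by rewrite subv_cap addvS ?hit0_P0 ?capvSl // subv_add hit0_subv capvSr.
apply/subvP => f /memv_capP[/memv_addP[g Pg [u Uu Df]] hf].
have pu0 : proj (@P0pred k d) u = 0.
  apply/ffunP => a; rewrite projE [RHS]ffunE; case: ifPn => // Pa; apply/eqP.
  by apply: contraTT Pa => /(mspanP _ _ (UP u Uu)); rewrite PplusP0.
have hg : g \in hit0 k d.
  by have := proj_hit hf; rewrite Df linearD /= pu0 addr0 proj_id.
rewrite Df memv_add // memv_cap Uu.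
by rewrite -(addKr g u) -Df rpredD // rpredN (subvP (hit0_subv k d)).
Qed.

Lemma kam_even k m (a : mon k (m.*2 + k)) j : ~~ odd (expo a j) -> kam (monom a) = 0.
Proof.
move=> aj; apply/ffunP => b; rewrite [LHS]ffunE [RHS]ffunE; apply: big1 => c /forallP Ec.
rewrite monomE; case: eqP => // ca; move: aj; rewrite -ca (eqP (Ec j)) /= odd_double //.
Qed.

Lemma mem_ker_kam k m (f : Pd k (m.*2 + k)) :
  (f \in linfun (@kam k m) @^-1: hit k m)%VS = (kam f \in hit k m).
Proof. by rewrite -memv_preim lfunE. Qed.

Lemma wt0_even k (e : 'I_k -> nat) : (wt 0 e < k)%N -> exists j, ~~ odd (e j).
Proof.
move=> lt_e; apply/existsP; apply: contraTT lt_e; rewrite negb_exists => /forallP no.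
rewrite -leqNgt wt0E (eq_bigr (fun=> 1%N)) ?sum1_card ?card_ord // => j _.
by have := no j; rewrite negbK => ->.
Qed.

Lemma qdim_decomposition k d (K W : {vspace Pd k d}) (U : {vspace Pd k d}) :
  (U <= Pplus k d)%VS -> K = (P0 k d + U + hit k d)%VS -> (U :&: W = U :&: hit k d)%VS ->
  qdim K (hit k d) = (qdim (P0 k d) (hit0 k d) + qdim U W)%N.
Proof.
move=> UP DK UW; rewrite /qdim UW.
rewrite (capv_idPr _) ?DK ?addvSr // (capv_idPr (hit0_P0 k d)).
have PU0 : (P0 k d :&: U = 0)%VS.
  by apply/eqP; rewrite -subv0 -(cap_P0_Pplus k d) capvS.
have hU0 : (hit0 k d :&: (U :&: hit k d) = 0)%VS.
  by apply/eqP; rewrite -subv0 -PU0 capvS ?hit0_P0 ?capvSl.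
have := dimv_sum_cap (P0 k d + U)%VS (hit k d).
rewrite cap_hit_add // (dimv_disjoint_sum PU0) (dimv_disjoint_sum hU0).
(* Subtraction in [qdim] is truncated, so the inclusions are needed for the arithmetic. *)
have := dimvS (hit0_P0 k d); have := dimvS (capvSl U (hit k d)).
lia.
Qed.

Local Close Scope ring_scope.

(* Ker (Sq0~)_(5,24) ~= (QP_5^0)_53 (+) QP_5^+(3,3,3,2,1), as F_2-vector spaces
   (finite-dimensional, so: equality of dimensions). *)
Theorem theorem3p7 :
  dim_ker_kameko 5 24 = (dim_QP0 5 53 + dim_QPplus_w 5 [:: 3; 3; 3; 2; 1])%N.
Proof.
rewrite /dim_QPplus_w /dim_QP0 /dim_ker_kameko.
have -> : degw [:: 3; 3; 3; 2; 1]%N = 53%N by rewrite /degw /= !big_ord_recl big_ord0.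
rewrite -[(24.*2 + 5)%N]/53%N.
apply: qdim_decomposition; first exact: capvSl.
  apply/eqP; rewrite eqEsubv; apply/andP; split.
    (* A kernel element is hit modulo monomials of first weight below 5, hence modulo
       $P_5(3,3,3,2,1)$, whose monomials lie in $P_5^0$ or $P_5^+$. *)
    apply/subvP => f; rewrite (@mem_ker_kam 5 24) => /(@kam_reconstruct 5 24).
    have /subvP: (hit 5 53 + mspan (fun b : mon 5 53 => wt 0 (expo b) < 5)%N <= S53)%VS.
      by rewrite subv_add addvSl wt_lt5_S53.
    move=> HS /HS; apply: subvP; rewrite /S53 addvC; apply: addvS => //.
    apply: mspan_subv => b Wb; case: (boolP (P0pred b)) => Pb.
      by apply: (subvP (addvSl _ _)); apply: monom_mspan.
    apply: (subvP (addvSr _ _)); rewrite memv_cap !monom_mspan //.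
    by rewrite PplusP0.
  (* Conversely [kam] kills monomials with an even exponent: those of $P_5^0$ have a zero exponent,
     those of $P_5(3,3,3,2,1)$ have first weight at most 3. *)
  rewrite subv_add (kam_hit 5 24) andbT subv_add; apply/andP; split.
    apply: mspan_subv => b /existsP[j /eqP bj]; rewrite (@mem_ker_kam 5 24).
    by rewrite (@kam_even 5 24 b j) ?rpred0 // bj.
  apply: subv_trans (capvSr _ _) _; apply: mspan_subv => b Wb.
  have /wt0_even[j bj] : (wt 0 (expo b) < 5)%N.
    case/orP: Wb; last by rewrite lexlt53; case: (ltngtP _ 3%N) => [/ltn_trans->||->].
    by rewrite omega53 padw53 => /eqP[-> _].
  by rewrite (@mem_ker_kam 5 24) (@kam_even 5 24 b j) ?rpred0.
(* Since $P_5^-(3,3,3,2,1)$ is hit, the denominator of $QP_5^+(3,3,3,2,1)$ consists of the hit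
   elements of the numerator. *)
apply/eqP; rewrite eqEsubv; apply/andP; split.
  apply: capvS => //; rewrite subv_add; apply/andP; split.
    exact: subv_trans (capvSl _ _) (capvSl _ _).
  exact: subv_trans (capvSr _ _) Pwminus_hit.
rewrite subv_cap capvSl; apply: subv_trans (addvSl _ _).
by rewrite -[X in (_ <= X)%VS]capvA [X in (_ <= X)%VS]capvC.
Qed.
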